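(* Let $X$ be an abelian Polish group and let $A\subseteq X$. Then the following are equivalent: (1) $A$ is Haar meager. (2) There are a nonempty compact set $K\subseteq X$ and a continuous function $g:K\to X$ which is a witness function for $A$.
   Context: An abelian Polish group is an abelian topological group (written additively) whose topology is separable and completely metrizable. For $B\subseteq X$ and $x\in X$, $B+x=\{b+x : b\in B\}$. A subset of a topological space is meager in that space if it is a countable union of nowhere dense subsets of that space. For a nonempty compact metrizable space $K$, a continuous function $f:K\to X$ is called a witness function for $A\subseteq X$ if there is a Borel set $B\subseteq X$ with $A\subseteq B$ such that $f^{-1}(B+x)$ is meager in $K$ for every $x\in X$. The set $A$ is Haar meager if there exist a nonempty compact metric space $K$ and a continuous $f:K\to X$ which is a witness function for $A$. A compact subset of $X$ is regarded as a compact metrizable space with the subspace topology. *)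

(* Defs.v *)
From HB Require Import structures.
From mathcomp Require Import all_boot all_order all_algebra.
From mathcomp Require Import all_classical all_reals all_analysis.

Set Implicit Arguments.
Unset Strict Implicit.
Unset Printing Implicit Defensive.

Import Order.TTheory GRing.Theory Num.Theory.

Local Open Scope classical_set_scope.
Local Open Scope ring_scope.

Definition separable (T : topologicalType) : Prop :=
  exists2 D : set T, countable D & dense D.

(* Stated with sequences, since the library's [completeType] is phrased with
   Cauchy filters; [cauchy] is the library's notion for the filter [u @ \oo],
   i.e. the usual epsilon-N condition. *)
Definition complete_metric (R : realType) (M : metricType R) : Prop :=
  forall u : nat -> M, cauchy (u @ \oo) -> exists l : M, u @ \oo --> l.

Definition completely_metrizable (R : realType) (T : topologicalType) : Prop :=
  exists (M : metricType R) (h : T -> M) (g : M -> T),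
    [/\ complete_metric M, continuous h, continuous g,
        cancel h g & cancel g h].

Definition polish (R : realType) (T : topologicalType) : Prop :=
  separable T /\ completely_metrizable R T.

Definition nowhere_dense (T : topologicalType) (A : set T) : Prop :=
  interior (closure A) = set0.

Definition meager (T : topologicalType) (A : set T) : Prop :=
  exists2 F : nat -> set T,
    (forall n, nowhere_dense (F n)) & A = \bigcup_n F n.

Definition borel (T : topologicalType) (B : set T) : Prop := <<s open >> B.

Definition translate (X : zmodType) (B : set X) (x : X) : set X :=
  [set b + x | b in B].

Definition witness_function (X : topologicalZmodType) (K : topologicalType)
    (f : K -> X) (A : set X) : Prop :=
  continuous f /\
  exists B : set X, [/\ borel B, A `<=` B &
    forall x : X, meager (f @^-1` translate B x)].

Definition haar_meager (R : realType) (X : topologicalZmodType) (A : set X)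
    : Prop :=
  exists (K : metricType R) (f : K -> X),
    [/\ [set: K] !=set0, compact [set: K] & witness_function f A].

(* Main.v *)
Require Import Defs.
From HB Require Import structures.
From mathcomp Require Import all_boot all_order all_algebra.
From mathcomp Require Import all_classical all_reals all_analysis.
From mathcomp Require Import lra.

(** If [p : K' -> K] is continuous and pulls meager sets back to meager sets, and
    [f : K -> X] is a witness function for [A], then so is [f \o p]
    ([witness_function_comp]). The theorem thus asks for compact sets that can
    serve as domains of such maps [p], on either side of the equivalence.

    From a compact subset of [X] to a compact metric space, a complete metric of
    [X] is restricted to the subset, and [p] is the identity.

    Conversely let [f : K -> X] be a witness function on a compact metric space.
    If [0] is isolated, [X] is discrete, and Baire's theorem in [K] forces [A] to
    be empty ([discrete_haar_meager_set0]); the singleton of [0] then serves as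
    the compact set.
    Otherwise [X] has no isolated point, and a Cantor scheme embeds the Cantor
    space in [X] ([cantor_scheme_embedding]). The Cantor space maps continuously
    onto [K] by the Alexandroff-Hausdorff theorem. Restrict this surjection to a
    closed set that is minimal among those still mapped onto [K]
    ([irreducible_restriction]). Such a restriction may fail to be open, but it
    sends nonempty open sets to sets with nonempty interior
    ([irreducible_image]), which suffices to pull back meager sets
    ([meager_preimage]). The image in [X] of the minimal closed set is the
    required compact subset ([semi_open_from_compact_subset]). *)

Set Implicit Arguments.
Unset Strict Implicit.
Unset Printing Implicit Defensive.

Local Open Scope classical_set_scope.

(** * Maps that pull back meager sets *)

(** A weakening of openness: weak enough to hold for irreducible surjections of
    compact Hausdorff spaces, strong enough to pull back meager sets. *)
Definition semi_open (S T : topologicalType) (p : S -> T) : Prop :=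
  forall U : set S, open U -> U !=set0 ->
    exists V : set T, [/\ open V, V !=set0 & V `<=` p @` U].

(** A closed set with nonempty interior cannot have its image inside a nowhere
    dense closed set, since that image contains a nonempty open set; hence
    nowhere dense sets pull back to nowhere dense sets. *)
Lemma meager_preimage (S T : topologicalType) (p : S -> T) (A : set T) :
  continuous p -> semi_open p -> meager A -> meager (p @^-1` A).
Proof.
move=> /continuous_closedP pc po [F Fnd ->].
exists (fun n => p @^-1` F n); last by rewrite preimage_bigcup.
move=> n; apply: contrapT => /eqP/set0P U0.
have [V [oV V0 VU]] := po _ (open_interior _) U0.
have clF : closure (p @^-1` F n) `<=` p @^-1` closure (F n).
  have /pc/closure_id-> := @closed_closure _ (F n).
  by apply: closureS => x /=; exact: subset_closure.
have : V `<=` interior (closure (F n)).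
  rewrite -open_subsetE//; apply: subset_trans VU _ => _ [x /interior_subset + <-].
  by move=> /clF.
by rewrite (Fnd n) => V00; case: V0 => v /V00.
Qed.

Lemma homeomorphism_semi_open (S T : topologicalType) (p : S -> T) (q : T -> S) :
  continuous q -> cancel p q -> cancel q p -> semi_open p.
Proof.
move=> /continuousP qc pK qK U oU [s Us]; exists (q @^-1` U); split.
- exact: qc.
- by exists (p s); rewrite /= pK.
- by move=> t /= Ut; exists (q t).
Qed.

(** The Borel hull of [A] is kept: only the preimages of its translates change,
    and they stay meager. *)
Lemma witness_function_comp (X : topologicalZmodType) (S T : topologicalType)
    (p : S -> T) (f : T -> X) (A : set X) :
  continuous p -> semi_open p -> witness_function f A ->
  witness_function (f \o p) A.
Proof.
move=> pc po [fc [B [bB AB mB]]]; split.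
  by move=> x; apply: continuous_comp; [exact: pc|exact: fc].
by exists B; split=> // x; rewrite comp_preimage; exact: meager_preimage.
Qed.

(** * Irreducible surjections *)

Definition irreducible_on (S : topologicalType) (T : Type) (h : S -> T)
    (C : set S) : Prop :=
  [/\ closed C, h @` C = setT &
    forall D, closed D -> D `<=` C -> h @` D = setT -> D = C].

(** Zorn's lemma applied to the open sets whose complement still maps onto [T].
    The union of a chain of them is again one: for each [y], the sets obtained by
    removing a member of the chain from the fibre of [y] form a chain of nonempty
    closed sets, so by compactness some point of the fibre avoids them all. *)
Lemma irreducible_restriction (S T : topologicalType) (h : S -> T) :
  compact [set: S] -> accessible_space T -> continuous h -> h @` setT = setT ->
  exists C : set S, irreducible_on h C.
Proof.
move=> cS T1 /continuous_closedP hc hT.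
pose P (N : set S) := open N /\ h @` (~` N) = setT.
have [F FP Ftot|N [[oO hO] Omax]] := @Zorn_bigcup _ P.
  split; first by apply: bigcup_open => i /FP[].
  have [->|/set0P[W FW]] := eqVneq F set0.
    by rewrite bigcup_set0 setC0.
  rewrite -subTset => y _.
  pose Q N := h @^-1` [set y] `\` N.
  have FF : ProperFilter (filter_from F Q).
    apply: filter_from_proper => [|N /FP[_ hO]].
      apply: filter_from_filter; first by exists W.
      move=> i j Fi Fj; case: (Ftot _ _ Fi Fj) => ij; [exists j|exists i] => //.
        by move=> z [zy jz]; split=> //; split=> // /ij.
      by move=> z [zy jz]; split=> //; split=> // /ij.
    by have : [set: T] y := I; rewrite -hO => -[z Oz zy]; exists z.
  have [|z [_ clz]] := cS _ FF; first exact: filterT.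
  have Qz N : F N -> Q N z.
    move=> FO; have /closure_id -> : closed (Q N).
      rewrite /Q setDE; apply: closedI.
        by apply: hc; exact: accessible_closed_set1.
      by apply: open_closedC; case: (FP N FO).
    by move=> B Bz; apply: clz => //; exists N.
  exists z; last by case: (Qz _ FW).
  by move=> [B FB Bz]; case: (Qz _ FB).
exists (~` N); split=> //; first exact: open_closedC.
move=> D cD DsubO hD; apply: contrapT => DneO; apply: (Omax (~` D)).
  rewrite properEneq; split; last by rewrite -[N]setCK; exact: subsetC.
  by apply/eqP => eOD; apply: DneO; rewrite eOD setCK.
by split; [exact: closed_openC|rewrite setCK].
Qed.

(** By minimality [C `\` U] misses some point of [T], and the complement of its
    closed image is an open set whose points only have preimages in [U]. *)
Lemma irreducible_image (S T : topologicalType) (h : S -> T) (C U : set S) :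
  compact [set: S] -> hausdorff_space T -> continuous h ->
  irreducible_on h C -> open U -> U `&` C !=set0 ->
  exists V, [/\ open V, V !=set0 & V `<=` h @` (U `&` C)].
Proof.
move=> cS hT hc [cC hC Cmin] oU [s [Us Cs]].
have cCU : closed (C `\` U) by rewrite setDE; apply: closedI => //; exact: open_closedC.
exists (~` (h @` (C `\` U))); split.
- apply: closed_openC; apply: compact_closed => //.
  apply: continuous_compact; first exact: continuous_subspaceT.
  exact: subclosed_compact cCU cS _.
- apply: contrapT => /set0P/negP/negPn/eqP hCU0.
  have CUC : C `\` U = C.
    by apply: Cmin => //; rewrite -[LHS]setCK hCU0 setC0.
  by move: Cs; rewrite -CUC => -[].
- move=> y nCUy; have : [set: T] y by []; rewrite -hC => -[z Cz zy].
  exists z => //; split=> //; apply: contrapT => nUz.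
  by apply: nCUy; exists z.
Qed.

(** * Baire category in compact spaces *)

(** The Baire category theorem for compact regular spaces: shrink [U] to open
    sets whose closures avoid the nowhere dense sets one after the other; a
    cluster point of points chosen in them lies in [U] and avoids all of them. *)
Lemma compact_regular_baire (T : topologicalType) (U : set T) :
  compact [set: T] -> regular_space T -> open U -> meager U -> U = set0.
Proof.
move=> cT regT oU [F Fnd UF]; apply/eqP; apply: contrapT => /negP/set0P U0.
pose P (V : set T) := open V /\ V !=set0.
have step (nV : nat * set T) : exists W, P nV.2 ->
    [/\ P W, closure W `<=` nV.2 & closure W `<=` ~` F nV.1].
  case: nV => n V /=.
  have [[oV V0]|] := pselect (P V); last by exists set0.
  have [x [Vx Fx]] : exists x, V x /\ ~ closure (F n) x.
    apply: contrapT => /forallNP VF; have : V `<=` interior (closure (F n)).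
      rewrite -open_subsetE// => x Vx; apply: contrapT => Fx.
      exact: (VF x).
    by rewrite Fnd => V00; case: V0 => v /V00.
  have : nbhs x (V `&` ~` closure (F n)).
    apply: open_nbhs_nbhs; split=> //; apply: openI => //.
    by apply: closed_openC; exact: closed_closure.
  case/regT => W xW WV; exists (interior W) => _; split.
  - by split; [exact: open_interior|exists x].
  - by move=> y /(closureS (@interior_subset _ W)) /WV[].
  - by move=> y /(closureS (@interior_subset _ W)) /WV[_ yF] /subset_closure.
have [f fP] := choice step.
pose fix V n := if n is m.+1 then f (m, V m) else U.
have PV n : P (V n) by elim: n => //= n /(fP (n, V n))[].
have Vsub n m : (n <= m)%N -> V m `<=` V n.
  elim: m => [|m IH]; first by rewrite leqn0 => /eqP->.
  rewrite leq_eqVlt => /predU1P[->//|/IH]; apply: subset_trans.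
  have [_ + _] := fP (m, V m) (PV m); apply: subset_trans.
  exact: subset_closure.
(* [V n.+1] avoids [F n], whence the shift in the last steps. *)
have [x xV] := choice (fun n => (PV n).2).
have [|p [_ clp]] := cT (x @ \oo) _; first exact: filterT.
have Vp n : closure (V n) p.
  by move=> B pB; apply: clp => //; exists n => // m /= /Vsub; exact.
have [_ UV _] := fP (0%N, U) (PV 0%N).
have : U p by apply: UV; exact: (Vp 1%N).
rewrite UF => -[n _]; have [_ _] := fP (n, V n) (PV n); apply.
exact: (Vp n.+1).
Qed.

(** * Embedding the Cantor space *)

Import Order.TTheory GRing.Theory Num.Theory.
Import metricType_numDomainType.
Local Open Scope ring_scope.

Lemma cantor_space_near_prefix (s : cantor_space) (n : nat) :
  \forall t \near s, forall i, (i < n)%N -> s i = t i.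
Proof.
elim: n => [|n IH]; first by near=> t => ?; rewrite ltn0.
near=> t => i; rewrite ltnS leq_eqVlt => /predU1P[->|ilt]; last first.
  by move: i ilt; near: t.
near: t; exists (proj n @^-1` [set s n]); split => //.
  suff : @open cantor_space (proj n @^-1` [set s n]) by [].
  apply: open_comp; [move=> + _; exact: proj_continuous|exact: discrete_open].
Unshelve. all: end_near. Qed.

(** A tree of balls in a complete metric space without isolated points. The
    children of a ball of centre [c] are balls around [c] and around a second
    point at distance [d] from [c]; their radius [d / 3] keeps the two closed
    balls disjoint, and [d] below half of the previous radius keeps both of them
    inside the parent ball. *)
Section cantor_scheme.
Variables (R : realType) (M : metricType R) (a : M).
Hypothesis completeM : complete_metric M.
Hypothesis isolM : forall c : M, ~ open [set c].

Let near_point (p : M * R) :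
  exists y, 0 < p.2 -> y != p.1 /\ mdist p.1 y < p.2 / 2.
Proof.
case: p => c r /=; apply: contrapT => /forallNP cy.
have [r0|r0] := ltP 0 r; last by apply: (cy c); rewrite ltNge r0.
apply: (isolM (c := c)); rewrite openE /= => _ /= ->.
apply/nbhs_ballP; exists (r / 2); first by rewrite /= divr_gt0.
move=> y; rewrite ballEmdist /= => yr; apply: contrapT => /eqP yc.
by apply: (cy y).
Qed.

Let twin p := projT1 (cid (near_point p)).

Let twin_neq p : 0 < p.2 -> twin p != p.1.
Proof. by rewrite /twin; case: cid => y /= + /[dup] r0 /= => /[apply] -[]. Qed.

Let twin_close p : 0 < p.2 -> mdist p.1 (twin p) < p.2 / 2.
Proof. by rewrite /twin; case: cid => y /= + /[dup] r0 /= => /[apply] -[]. Qed.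

Let child (p : M * R) (b : bool) : M * R :=
  (if b then twin p else p.1, mdist p.1 (twin p) / 3).

Fixpoint scheme (s : nat -> bool) (n : nat) : M * R :=
  if n is m.+1 then child (scheme s m) (s m) else (a, 1).

Let rad_gt0 s n : 0 < (scheme s n).2.
Proof.
elim: n => [|n IH] /=; first exact: ltr01.
by rewrite divr_gt0// mdist_gt0 eq_sym twin_neq.
Qed.

Let rad_half s n : (scheme s n.+1).2 <= (scheme s n).2 / 2.
Proof.
have := twin_close (rad_gt0 s n); have := rad_gt0 s n => /=.
by have := mdist_ge0 (scheme s n).1 (twin (scheme s n)); lra.
Qed.

Let rad_le s n : (scheme s n).2 <= 2^-1 ^+ n.
Proof.
elim: n => [|n IH]; first by rewrite expr0.
by rewrite exprS; have := rad_half s n; move: IH; lra.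
Qed.

Let ball_nested s n z : mdist (scheme s n.+1).1 z <= (scheme s n.+1).2 ->
  mdist (scheme s n).1 z <= (scheme s n).2.
Proof.
have := twin_close (rad_gt0 s n); have := rad_gt0 s n => /=.
set c := (scheme s n).1; set y := twin _ => r0 yr.
have d0 := mdist_ge0 c y.
case: (s n) => cz; last by move: cz; lra.
have := metric_triangle c y z; move: cz; lra.
Qed.

Let center_in_ball s n k : mdist (scheme s n).1 (scheme s (n + k)).1 <= (scheme s n).2.
Proof.
elim: k n => [|k IH] n; first by rewrite addn0 mdistxx ltW.
by apply: ball_nested; rewrite addnS -addSn.
Qed.

Let small_radius e : 0 < e -> exists n, forall s, (scheme s n).2 < e.
Proof.
move=> e0; have h0 : 0 < 2^-1 :> R by rewrite invr_gt0.
have := @cvg_geometric _ 1 (2^-1 : R); rewrite gtr0_norm// invf_lt1// ltr1n.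
move=> /(_ isT) /(@cvgrPdist_lt _ R^o) /(_ e e0)[n _ /(_ n (leqnn n))].
rewrite /mdist /= subr0 mul1r normrX gtr0_norm// => ne.
by exists n => s; apply: le_lt_trans (rad_le s n) ne.
Qed.

Let limit_exists s : exists l : M, (scheme s n).1 @[n --> \oo] --> l.
Proof.
apply: completeM; apply: cauchy_exP => e /small_radius[n ne].
exists (scheme s n).1; exists n => // m /= nm; rewrite ballEmdist /=.
by rewrite (le_lt_trans _ (ne s))// -(subnKC nm) center_in_ball.
Qed.

Let limit s := projT1 (cid (limit_exists s)).

Let limit_in_ball s n : mdist (scheme s n).1 (limit s) <= (scheme s n).2.
Proof.
apply/ler_addgt0Pl => e e0.
rewrite /limit; case: cid => l /= /cvgrPdist_lt /(_ e e0)[m _ ml].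
have /= := ml (n + m)%N (leq_addl _ _) => le.
have := metric_triangle (scheme s n).1 (scheme s (n + m)).1 l.
rewrite [mdist (scheme s (n + m)).1 l]metric_sym.
by have := center_in_ball s n m; move: le; lra.
Qed.

Let scheme_prefix s t n : (forall i, (i < n)%N -> s i = t i) ->
  scheme s n = scheme t n.
Proof.
elim: n => //= n IH st; rewrite IH ?st//.
by move=> i /ltnW; exact: st.
Qed.

(** Branches with a long common prefix have limits in a common small ball, and
    branches that split have limits in disjoint closed balls. *)
Lemma cantor_scheme_embedding :
  exists e : cantor_space -> M, continuous e /\ injective e.
Proof.
exists limit; split.
  move=> s; apply/cvgrPdist_lt => e e0.
  have [|n ne] := @small_radius (e / 2); first by rewrite divr_gt0.
  near=> t; have st : scheme s n = scheme t n.
    by apply: scheme_prefix; near: t; exact: cantor_space_near_prefix.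
  have := limit_in_ball s n; have := limit_in_ball t n; rewrite -st.
  rewrite [mdist _ (limit s)]metric_sym.
  have := metric_triangle (limit s) (scheme s n).1 (limit t).
  have := ne s; lra.
move=> s t st; suff pre n : forall i, (i < n)%N -> s i = t i.
  by apply/funext => n; exact: (pre n.+1).
elim: n => // n IH i; rewrite ltnS leq_eqVlt => /predU1P[->|/IH//].
have := limit_in_ball s n.+1; have := limit_in_ball t n.+1; rewrite -st /=.
rewrite -(scheme_prefix IH); set c := (scheme s n).1; set y := twin _.
have d0 : 0 < mdist c y by rewrite mdist_gt0 eq_sym twin_neq.
have := metric_triangle c (limit s) y; rewrite [mdist (limit s) y]metric_sym.
case: (s n); case: (t n) => // h1 h2 h3; exfalso; move: h1 h2 h3 d0; lra.
Unshelve. all: end_near. Qed.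
End cantor_scheme.

(** * Compact subsets as metric spaces *)

Lemma compact_setT_set_type (T : topologicalType) (K : set T) :
  compact K -> compact [set: K].
Proof.
move=> cK F FF _.
have FK : ((set_val : K -> T) @ F) K.
  by apply: (@filterS _ F _ setT) filterT => k _; exact: set_valP.
have [x [Kx clx]] := cK _ (fmap_proper_filter _ FF) FK.
exists (exist _ x (mem_set Kx)); split=> // A B FA [_ [[C oC <-] Cx CB]].
have [||y [[k Ak <-] Cy]] := clx (set_val @` A) C.
- by apply: (@filterS _ F _ A) FA => k Ak; exists k.
- exact: open_nbhs_nbhs.
by exists k; split=> //; apply: CB.
Qed.

(** An initial topology inherits a pseudometric from [M] in general; it is a
    metric because [f] separates points. *)
Section initial_metric.
Variables (R : realType) (S : choiceType) (M : metricType R) (f : S -> M).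
Hypothesis injf : injective f.

Let dist (x y : initial_topology f) : R := mdist (f x) (f y).

Let dist_ge0 x y : 0 <= dist x y. Proof. exact: mdist_ge0. Qed.

Let dist_positivity x y : dist x y = 0 -> x = y.
Proof. by move/mdist_positivity/injf. Qed.

Let ballEdist (x : initial_topology f) (d : R) :
  ball x d = [set y | dist x y < d].
Proof. by rewrite -initial_ballE ballEmdist. Qed.

Definition initial_metric : metricType R := HB.pack (initial_topology f)
  (PseudoMetric_isMetric.Build R (initial_topology f)
     dist_ge0 dist_positivity ballEdist).

End initial_metric.

(** * Changing the domain of a witness function *)

(** An irreducible restriction of a surjection from the Cantor space onto [K0],
    transported along [e]. *)
Lemma semi_open_from_compact_subset (X : topologicalType) (e : cantor_space -> X)
    (R : realType) (K0 : metricType R) :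
  hausdorff_space X -> continuous e -> injective e ->
  [set: K0] !=set0 -> compact [set: K0] ->
  exists (K : set X) (p : K -> K0),
    [/\ K !=set0, compact K, continuous p & semi_open p].
Proof.
move=> hX ec einj [k0 _] cK0.
pose PK0 : pseudoPMetricType R := HB.pack K0 (isPointed.Build K0 k0).
have hK0 := @metric_hausdorff _ K0.
have [h hc] := @cantor_surj R PK0 cK0 hK0.
have hT : h @` setT = [set: K0].
  by rewrite -subTset => y /(@surj _ _ _ _ h).
have cC := cantor_space_compact.
have [C Cirr] :=
  @irreducible_restriction cantor_space K0 h cC (hausdorff_accessible hK0) hc hT.
have [clC hC _] := Cirr.
have eclosed D : closed D -> closed (e @` D).
  move=> clD; apply: compact_closed => //; apply: continuous_compact.
    exact: continuous_subspaceT.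
  exact: subclosed_compact clD cC _.
have /choice[i iP] : forall k : e @` C, exists s, C s /\ e s = set_val k.
  by move=> k; have [s Cs es] := set_valP k; exists s.
exists (e @` C), (h \o i); split.
- have : [set: K0] k0 by []; rewrite -hC => -[s Cs _].
  by exists (e s), s.
- apply: continuous_compact; first exact: continuous_subspaceT.
  exact: subclosed_compact clC cC _.
- apply/continuous_closedP => F clF.
  have -> : (h \o i) @^-1` F = (set_val : e @` C -> X) @^-1` (e @` (h @^-1` F)).
    apply/seteqP; split=> k /=.
      by move=> Fk; exists (i k) => //; case: (iP k).
    by move=> [s Fs es]; have [_ /esym] := iP k; rewrite -es => /einj <-.
  move: (@initial_continuous (e @` C) X set_val) => /continuous_closedP; apply.
  by apply: eclosed; move/continuous_closedP: hc; exact.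
- (* An open set of the subspace is the trace of an open [W] of [X]. *)
  move=> _ [W oW <-] [k Wk].
  have [] := @irreducible_image _ _ h C (e @^-1` W) cC hK0 hc Cirr.
  + by move/continuousP: ec; exact.
  + by exists (i k); have [? ik] := iP k; split=> //=; rewrite ik.
  move=> V [oV V0 VW]; exists V; split=> //.
  move=> v /VW [s [Ws Cs] <-].
  have Ks : e s \in e @` C by apply/mem_set; exists s.
  exists (exist _ (e s) Ks) => //=; congr (h _); apply: einj.
  by have [_ ->] := iP (exist _ (e s) Ks).
Qed.

Lemma open_set1_translate (X : topologicalZmodType) (x y : X) :
  open [set x] -> open [set y].
Proof.
move=> ox; have tc : continuous (fun z : X => z + (x - y)).
  move=> z; apply: (@continuous_comp _ _ _ (fun z : X => (z, x - y))
    (fun p : X * X => p.1 + p.2)); last exact: add_continuous.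
  by apply: cvg_pair => /=; [exact: cvg_id|exact: cvg_cst].
have -> : [set y] = (fun z : X => z + (x - y)) @^-1` [set x].
  apply/seteqP; split=> [z ->|z] /=; first by rewrite addrC subrK.
  by move=> /(canRL (addrK _)) ->; rewrite opprB addrC subrK.
by move/continuousP : tc; exact.
Qed.

(** Preimages of translates are clopen when [X] is discrete, and by Baire's
    theorem a meager one is empty. A Borel hull with a point would have a
    translate that meets the range of [f]. *)
Lemma discrete_haar_meager_set0 (R : realType) (X : topologicalZmodType)
    (K : metricType R) (f : K -> X) (A : set X) :
  open [set (0 : X)] -> [set: K] !=set0 -> compact [set: K] ->
  witness_function f A -> A = set0.
Proof.
move=> o0 [k _] cK [fc [B [_ AB mB]]]; apply/eqP; apply: contrapT => /negP/set0P.
move=> [b /AB Bb].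
have oB x : open (translate B x).
  rewrite /translate -bigcup_imset1; apply: bigcup_open => y _.
  exact: open_set1_translate o0.
have H := compact_regular_baire cK (@uniform_regular K) _ (mB (f k - b)).
have : (f @^-1` translate B (f k - b)) k.
  by exists b => //; rewrite addrC subrK.
by rewrite H//; move/continuousP: fc; exact.
Qed.

Lemma set0_has_witness (X : topologicalZmodType) :
  exists (K : set X) (g : K -> X),
    [/\ K !=set0, compact K & witness_function g set0].
Proof.
exists [set 0], set_val; split.
- by exists 0.
- exact: compact_set1.
split; first exact: initial_continuous.
exists set0; split=> [||x]; first by apply: sub_sigma_algebra; exact: open0.
  by [].
rewrite /translate image_set0 preimage_set0; exists (fun=> set0).
  by move=> _; rewrite /nowhere_dense closure0 interior0.
by rewrite bigcup0.
Qed.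

Local Close Scope ring_scope.

(* The coercion [set_type] makes [K : set X] a type, which carries the subspace
   topology. *)
Theorem theorem2p11 (R : realType) (X : topologicalZmodType) (hX : polish R X)
    (A : set X) :
  haar_meager R A <->
  exists (K : set X) (g : K -> X),
    [/\ K !=set0, compact K & witness_function g A].
Proof.
have [_ [M [h [g [Mc hc gc hK gK]]]]] := hX.
split=> [[K [f [K0 cK fA]]]|[K [f [K0 cK fA]]]].
  have [disc|ndisc] := pselect (open [set (0 : X)%R]).
    by rewrite (discrete_haar_meager_set0 disc K0 cK fA); exact: set0_has_witness.
  have isolM (c : M) : ~ open [set c].
    move=> oc; apply: ndisc; apply: (@open_set1_translate X (g c)).
    have -> : [set g c] = h @^-1` [set c].
      by apply/seteqP; split=> x /= => [->|<-]; rewrite ?gK ?hK.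
    by move/continuousP: hc; exact.
  have [e [ec einj]] := cantor_scheme_embedding (h 0%R) Mc isolM.
  have hausX : hausdorff_space X.
    move=> x y xy; apply: (can_inj hK); apply: (@metric_hausdorff _ M).
    move=> U V xU yV; have [z [Uz Vz]] := xy _ _ (hc _ _ xU) (hc _ _ yV).
    by exists (h z).
  have gec : continuous (g \o e).
    by move=> s; apply: continuous_comp; [exact: ec|exact: gc].
  have geinj : injective (g \o e) := inj_comp (can_inj gK) einj.
  have [K' [p [K'0 cK' pc po]]] :=
    semi_open_from_compact_subset hausX gec geinj K0 cK.
  exists K', (f \o p); split=> //; exact: witness_function_comp.
(* The set [K] with the distance carried over from [M] by [h]. *)
have hinj : injective (h \o (set_val : K -> X)).
  by move=> x y /(can_inj hK); exact: val_inj.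
pose W := initial_metric hinj.
have toc : continuous (id : K -> W).
  apply: continuous_comp_initial => x.
  apply: (@continuous_comp K X M set_val h); last exact: hc.
  exact: (@initial_continuous K X set_val).
have ofc : continuous (id : W -> K).
  apply: continuous_comp_initial.
  have -> : set_val \o (id : W -> K) = g \o (h \o (set_val : K -> X)).
    by apply/funext => x /=; rewrite hK.
  move=> x; apply: (@continuous_comp W M X (h \o (set_val : K -> X)) g).
      exact: (@initial_continuous _ M (h \o (set_val : K -> X))).
    exact: gc.
exists W, (f \o (id : W -> K)); split.
- by case: K0 => x Kx; exists (exist _ x (mem_set Kx)).
- rewrite -[X in compact X](image_id [set: W]).
  apply: (@continuous_compact K W id); first exact: continuous_subspaceT.
  exact: compact_setT_set_type.
- apply: witness_function_comp => //.
  exact: (@homeomorphism_semi_open W K id id).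
Qed.
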